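(* Let $d=2$ and $X_1,X_2\subseteq\mathbb R^n$, and choose any point $(\bar\alpha,\bar x_1,\bar x_2)\in(0,\infty)\times X_1\times X_2$ where $D^2_{x_1x_2}b(\bar x_1,\bar x_2)$ is non-singular. Let $\pi$ maximize $\int x_0\,b(x_1,x_2)\,d\pi(x_0,x_1,x_2)$ over $\Gamma(\mu_0,\mu_1,\mu_2)$. Then in a neighbourhood of $(\bar\alpha,\bar x_1,\bar x_2)$ the support of $\pi$ is contained in a Lipschitz submanifold of dimension at most $n+1$. Furthermore, if $$D_{x_2}b(\bar x_1,\bar x_2)\cdot[D^2_{x_1x_2}b(\bar x_1,\bar x_2)]^{-1}D_{x_1}b(\bar x_1,\bar x_2)>0,$$ then the dimension is at most $n$.
   Context: $b$ is a $C^2$ real-valued function of $(x_1,x_2)\in\mathbb R^n\times\mathbb R^n$; $D_{x_i}b$ is the gradient in $x_i$, and $D^2_{x_1x_2}b=\big(\frac{\partial^2b}{\partial x_1^r\partial x_2^l}\big)_{rl}$ is the $n\times n$ matrix of mixed second derivatives. $\mu_i\in\mathcal P(X_i)$ for $i=1,2$, and $\mu_0=\alpha_\#\mathrm{Leb}_{[0,1]}$ is the push-forward of Lebesgue measure on $[0,1]$ by the nondecreasing spectral function $\alpha:[0,1]\to[0,\infty)$. $\Gamma(\mu_0,\mu_1,\mu_2)$ is the set of Borel probability measures on the product space with marginals $\mu_0,\mu_1,\mu_2$. *)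

(* Defs.v *)
From HB Require Import structures.
From mathcomp Require Export all_boot all_order all_algebra.
From mathcomp Require Export all_classical all_reals all_analysis.

Set Implicit Arguments.
Unset Strict Implicit.
Unset Printing Implicit Defensive.

Export Order.TTheory GRing.Theory Num.Theory.
Export numFieldNormedType.Exports.

Open Scope classical_set_scope.
Open Scope ring_scope.

(* [R^n] is ['rV[R]_n]; a point of [R^n * R^n] is a pair [(x1, x2)] and a point
   of [R * R^n * R^n] is [(x0, x1, x2) = ((x0, x1), x2)]. *)
Notation pair_space R n := ('rV[R]_n * 'rV[R]_n)%type.
Notation triple_space R n := (R * 'rV[R]_n * 'rV[R]_n)%type.

Notation borel T := (g_sigma_algebraType (@open T)).

Section calculus.
Context {R : realType}.

(* On a finite-dimensional [V], continuity of ['D_v f] for every fixed [v] is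
   the same as continuity of the differential [p |-> 'd f p] in operator norm. *)
Definition C1 (V : normedModType R) (f : V -> R) : Prop :=
  (forall p, differentiable f p) /\ (forall v, continuous ('D_v f)).

Definition C2 (V : normedModType R) (f : V -> R) : Prop :=
  C1 f /\ (forall v, C1 ('D_v f)).

Definition e1 n (r : 'I_n) : pair_space R n := (delta_mx 0 r, 0).
Definition e2 n (l : 'I_n) : pair_space R n := (0, delta_mx 0 l).

Definition grad1 n (b : pair_space R n -> R) (x : pair_space R n) : 'rV[R]_n :=
  \row_r 'D_(e1 r) b x.

Definition grad2 n (b : pair_space R n -> R) (x : pair_space R n) : 'rV[R]_n :=
  \row_l 'D_(e2 l) b x.

Definition mixed_hessian n (b : pair_space R n -> R) (x : pair_space R n) :
    'M[R]_n :=
  \matrix_(r, l) 'D_(e2 l) ('D_(e1 r) b) x.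

(* Around each of its points, and after a linear change of coordinates
   identifying [V] with [R^k * R^m], the set [M] is the graph of a Lipschitz map
   from [R^k] to [R^m]. *)
Definition lipschitz_submanifold (V : normedModType R) (k : nat) (M : set V) :
    Prop :=
  forall p, M p ->
    exists (m : nat) (L : {linear ('rV[R]_k * 'rV[R]_m)%type -> V})
           (f : 'rV[R]_k -> 'rV[R]_m) (U : set V),
      [/\ bijective L, lipschitz f, nbhs p U
        & M `&` U = range (fun u => L (u, f u)) `&` U].

Definition locally_in_submanifold_of_dim_le (V : normedModType R) (d : nat)
    (S : set V) (p : V) : Prop :=
  exists (N M : set V) (k : nat),
    [/\ nbhs p N, (k <= d)%N, lipschitz_submanifold k M & S `&` N `<=` M].

End calculus.

Section transport.
Context {R : realType}.

(* Borel probability measures on a subspace [X] of [T], [X] not necessarily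
   Borel, correspond to the Borel probability measures on [T] for which [X] has
   outer measure 1; for a Borel set [X] this says [mu X = 1]. *)
Definition concentrated_on (T : normedModType R)
    (mu : probability (borel T) R) (X : set T) : Prop :=
  forall B : set (borel T), measurable B -> X `<=` B -> mu B = 1%E.

(* Topological support of a measure on the subspace [X]; the nonempty open sets
   of [X] are the traces of the open sets of [T]. *)
Definition support_in (T : normedModType R)
    (mu : probability (borel T) R) (X : set T) : set T :=
  [set p | X p /\ forall U : set T, open U -> U p -> (0 < mu U)%E].

(* The push-forward by [alpha] of the Lebesgue measure on [0, 1]; the values of
   [alpha] outside [0, 1] are irrelevant. *)
Definition spectral_law (alpha : R -> R) (A : set R) : \bar R :=
  lebesgue_measure (`[0, 1] `&` alpha @^-1` A).

Definition product_domain n (X1 X2 : set 'rV[R]_n) : set (triple_space R n) :=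
  [set x | [/\ 0 <= x.1.1, X1 x.1.2 & X2 x.2]].

Definition couplings n (X1 X2 : set 'rV[R]_n) (mu0 : set R -> \bar R)
    (mu1 mu2 : probability (borel 'rV[R]_n) R) :
    set (probability (borel (triple_space R n)) R) :=
  [set pi |
    [/\ concentrated_on pi (product_domain X1 X2),
        forall A : set R, measurable A ->
          pi [set x | A x.1.1] = mu0 A,
        forall A : set (borel 'rV[R]_n), measurable A ->
          pi [set x | A x.1.2] = mu1 A
      & forall A : set (borel 'rV[R]_n), measurable A ->
          pi [set x | A x.2] = mu2 A]].

Definition surplus n (b : pair_space R n -> R) (x : triple_space R n) : R :=
  x.1.1 * b (x.1.2, x.2).

(* The maximal value is required to be finite. A competitor for which the
   integral is of the form [oo - oo] is discarded, as the integral then takes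
   the conventional value [-oo]. *)
Definition maximizes n (b : pair_space R n -> R)
    (Gamma : set (probability (borel (triple_space R n)) R))
    (pi : probability (borel (triple_space R n)) R) : Prop :=
  [/\ Gamma pi,
      pi.-integrable setT (fun x => (surplus b x)%:E)
    & forall pi', Gamma pi' ->
        (\int[pi']_x (surplus b x)%:E <= \int[pi]_x (surplus b x)%:E)%E].

End transport.

(* Main.v *)
From HB Require Import structures.
Require Import Defs.
From mathcomp Require Import measurable_realfun ring lra.

Set Implicit Arguments.
Unset Strict Implicit.
Unset Printing Implicit Defensive.

(** Optimality forces [x0 b(x1,x2)] to be monotone on the support: exchanging
    one coordinate between two support points cannot raise the total surplus.
    Adding the three inequalities obtained by exchanging [x0], [x1] and [x2],
    and expanding [b] at the base point, one gets for two nearby support points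
    with difference [(t, D1, D2)]
      [a D1 H D2^T + t (D1 . g1 + D2 . g2) >= - e |(t, D1, D2)|^2],
    where [a] is the base value of [x0], [H] is the mixed Hessian and [g1], [g2]
    are the gradients of [b]. This quadratic form is negative definite on a
    space of dimension [n], and [n + 1] if [g2 H^-1 g1^T > 0]; hence locally the
    negative coordinates of the support are a Lipschitz function of the others,
    extended to the whole space by McShane's formula. *)

(** * Exchanging coordinates between two independent samples *)

Section product_square.
Local Open Scope ereal_scope.
Context d (T : measurableType d) (R : realType) (P : probability T R).

(** The push-forward of [P \x P] by [h] agrees with [P] on measurable sets, so this is a change of
    variables. It serves for the two projections. *)
Lemma integral_marginal (h : T * T -> T) (f : T -> R) :
  measurable_fun setT h ->
  (forall A, measurable A -> (P \x P) (h @^-1` A) = P A) ->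
  P.-integrable setT (EFin \o f) ->
  (P \x P).-integrable setT (EFin \o (f \o h)) /\
  \int[P \x P]_z (f (h z))%:E = \int[P]_x (f x)%:E.
Proof.
move=> mh hP fi; have mf := measurable_int _ fi.
have PE A : measurable A -> A `<=` setT -> pushforward (P \x P) h A = P A.
  by move=> mA _; exact: hP.
have ih : (P \x P).-integrable setT (EFin \o (f \o h)).
  apply/integrableP; split; first exact: (measurableT_comp mf mh).
  have /integrableP[_] := fi; apply: le_lt_trans.
  rewrite -(eq_measure_integral _ PE) ge0_integral_pushforward//.
  exact: measurableT_comp.
split=> //; rewrite -(eq_measure_integral _ PE).
by rewrite [RHS]integral_pushforward.
Qed.

Lemma product_fst A : measurable A -> (P \x P) (fst @^-1` A) = P A.
Proof.
move=> mA; rewrite (_ : fst @^-1` A = A `*` [set: T]); last first.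
  by apply/seteqP; split=> z //= [].
by rewrite -[RHS]mule1 -(probability_setT P); exact: product_measure1E.
Qed.

Lemma product_snd A : measurable A -> (P \x P) (snd @^-1` A) = P A.
Proof.
move=> mA; rewrite (_ : snd @^-1` A = [set: T] `*` A); last first.
  by apply/seteqP; split=> z //= [].
by rewrite -[RHS]mul1e -(probability_setT P); exact: product_measure1E.
Qed.

(** [X] need not be measurable, so the argument uses sections of [E]: over a point of [X] the
    section contains [X] and has mass 1; the points whose section has mass 1 form a measurable set
    containing [X], again of mass 1. Integrating over it gives the claim. *)
Lemma product_full (X : set T) (E : set (T * T)) :
  (forall B, measurable B -> X `<=` B -> P B = 1) ->
  measurable E -> X `*` X `<=` E -> (P \x P) E = 1.
Proof.
move=> PX mE XE; apply/eqP; rewrite eq_le probability_le1//=.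
pose g x := P (xsection E x).
have mg : measurable_fun setT g by exact: measurable_fun_xsection.
pose G := g @^-1` [set 1].
have mG : measurable G by rewrite -[G]setTI; exact: mg.
have PG : P G = 1.
  apply: (PX) => // x Xx; apply: PX; first exact: measurable_xsection.
  by move=> y Xy; apply/xsectionP; exact: XE.
rewrite -PG -[X in P X]setIT -integral_indic//.
apply: ge0_le_integral => //=.
- exact/measurable_EFinP/measurable_indic.
- move=> x _; rewrite indicE.
  have [|_] := boolP (x \in G); last exact: measure_ge0.
  by rewrite inE /G/= /g => ->.
Qed.

End product_square.

Section mean_law.
Local Open Scope ereal_scope.
Context d (T : measurableType d) (R : realType) (P : probability T R).
Variables Phi Psi : {mfun (T * T)%type >-> T}.

(** With [Phi, Psi] the two points obtained from a pair of independent samples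
    by exchanging some coordinates on an event, this is the competitor: the
    law of one of the two points chosen by a fair coin. It has the same
    marginals as [P], and building it as a push-forward avoids subtracting
    measures. *)
Definition mean_law : set T -> \bar R :=
  mscale (2^-1)%R%:nng%R
    (measure_add (distribution (P \x P) Phi) (distribution (P \x P) Psi)).

HB.instance Definition _ := Measure.on mean_law.

Lemma mean_lawE A : mean_law A =
  (2^-1)%:E * ((P \x P) (Phi @^-1` A) + (P \x P) (Psi @^-1` A)).
Proof.
rewrite /mean_law /mscale; congr (_ * _); exact: measure_addE.
Qed.

Lemma mean_law_eq1 A : (P \x P) (Phi @^-1` A) = 1 ->
  (P \x P) (Psi @^-1` A) = 1 -> mean_law A = 1.
Proof.
move=> h1 h2; rewrite mean_lawE h1 h2 -EFinD -EFinM.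
by congr EFin; rewrite mulVf.
Qed.

Let mean_law_setT : mean_law setT = 1.
Proof. by apply: mean_law_eq1; rewrite preimage_setT probability_setT. Qed.

HB.instance Definition _ :=
  Measure_isProbability.Build _ _ _ mean_law mean_law_setT.

(** The counting identity is integrated over [P \x P], and both projections have law [P]. *)
Lemma mean_law_marginal A : measurable A ->
  (forall z, (Phi z \in A) + (Psi z \in A) = (z.1 \in A) + (z.2 \in A))%N ->
  mean_law A = P A.
Proof.
move=> mA hA; rewrite mean_lawE.
have mPhi : measurable (Phi @^-1` A).
  by rewrite -[X in measurable X]setTI; exact: measurable_funP.
have mPsi : measurable (Psi @^-1` A).
  by rewrite -[X in measurable X]setTI; exact: measurable_funP.
have mfst : measurable (fst @^-1` A : set (T * T)).
  by rewrite -[X in measurable X]setTI; exact: measurable_fst.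
have msnd : measurable (snd @^-1` A : set (T * T)).
  by rewrite -[X in measurable X]setTI; exact: measurable_snd.
have cE B : measurable B -> (P \x P) B = \int[P \x P]_z (\1_B z)%:E.
  by move=> mB; rewrite integral_indic// setIT.
have mI B : measurable B ->
    measurable_fun setT (EFin \o (\1_B : T * T -> R)).
  by move=> mB; apply/measurable_EFinP; exact: measurable_indic.
have -> : (P \x P) (Phi @^-1` A) + (P \x P) (Psi @^-1` A) =
          (P \x P) (fst @^-1` A) + (P \x P) (snd @^-1` A).
  rewrite (cE _ mPhi) (cE _ mPsi) (cE _ mfst) (cE _ msnd).
  rewrite -!ge0_integralD//=; try exact: mI.
  apply: eq_integral => z _; rewrite -!EFinD; congr EFin.
  rewrite !indicE -!natrD; congr (_%:R).
  transitivity ((Phi z \in A) + (Psi z \in A))%N.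
    by congr (_ + _)%N; congr nat_of_bool; apply/idP/idP; rewrite !inE.
  rewrite hA.
  by congr (_ + _)%N; congr nat_of_bool; apply/idP/idP; rewrite !inE.
rewrite product_fst// product_snd//.
have : P A \is a fin_num by exact: fin_num_measure.
by move=> /fineK <-; rewrite -EFinD -EFinM; congr EFin; field.
Qed.

Lemma integral_mean_law (f : T -> R) : measurable_fun setT f ->
  (P \x P).-integrable setT (EFin \o (f \o Phi)) ->
  (P \x P).-integrable setT (EFin \o (f \o Psi)) ->
  \int[mean_law]_x (f x)%:E = (2^-1)%:E *
    (\int[P \x P]_z (f (Phi z))%:E + \int[P \x P]_z (f (Psi z))%:E).
Proof.
move=> mf if1 if2.
have mEf : measurable_fun setT (EFin \o f) by exact/measurable_EFinP.
have i1 : (distribution (P \x P) Phi).-integrable setT (EFin \o f).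
  by apply: integrable_pushforward.
have i2 : (distribution (P \x P) Psi).-integrable setT (EFin \o f).
  by apply: integrable_pushforward.
pose m := measure_add (distribution (P \x P) Phi) (distribution (P \x P) Psi).
(* A finite positive part rules out [oo - oo], so the factor 1/2 comes out of the difference. *)
have finp : \int[m]_x ((EFin \o f)^\+ x) \is a fin_num.
  rewrite ge0_integral_measure_add//; last exact: measurable_funepos.
  by rewrite fin_numD !integrable_fin_num//; exact: integrable_funepos.
rewrite integralE /mean_law !ge0_integral_mscale//=; last 2 first.
  exact: measurable_funeneg.
  exact: measurable_funepos.
rewrite -muleBr//; last exact: fin_num_adde_defr.
congr (_ * _).
have -> : \int[m]_x ((EFin \o f)^\+ x) - \int[m]_x ((EFin \o f)^\- x) =
  \int[m]_x (EFin \o f) x by rewrite [RHS]integralE.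
by rewrite integral_measure_add// !integral_pushforward.
Qed.

(** Outside the event nothing moves; on it the total rises by at least [del], and by independence it
    has mass [P U * P V > 0]. The bound [C] ensures integrability after the exchange. *)
Lemma swap_gain (s : T -> R) (U V : set T) (C del : R) :
  measurable U -> measurable V -> 0 < P U -> 0 < P V -> (0 < del)%R ->
  P.-integrable setT (EFin \o s) ->
  (forall z, ~ (U z.1 /\ V z.2) -> Phi z = z.1 /\ Psi z = z.2) ->
  (forall z, U z.1 -> V z.2 ->
    [/\ `|s (Phi z)| <= C, `|s (Psi z)| <= C
      & s z.1 + s z.2 + del <= s (Phi z) + s (Psi z)])%R ->
  \int[P]_x (s x)%:E < \int[mean_law]_x (s x)%:E.
Proof.
move=> mU mV PU0 PV0 del0 si out inn.
have [s1 s1E] := integral_marginal (@measurable_fst _ _ T T)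
  (@product_fst _ _ _ P) si.
have [s2 s2E] := integral_marginal (@measurable_snd _ _ T T)
  (@product_snd _ _ _ P) si.
have ms : measurable_fun setT s.
  by apply/measurable_EFinP; exact: measurable_int si.
pose W := U `*` V; have mW : measurable W by exact: measurableX.
have WP z : W z \/ ~ W z by exact: EM.
have iC : (P \x P).-integrable setT (EFin \o cst `|C|%R).
  exact: (@finite_measure_integrable_cst _ _ R
            ((P \x P) : probability (T * T)%type R)).
have iW : (P \x P).-integrable setT (EFin \o (\1_W : T * T -> R)).
  exact: (@integrable_indic _ _ R ((P \x P) : probability (T * T)%type R)).
(* Domination by [|s z.1| + |C|]: off [W] the value is [s z.1], on [W] it is at most [C] in absolute
   value. *)
have i1 : (P \x P).-integrable setT (EFin \o (s \o Phi)).
  apply: (le_integrable _ _ _ (integrableD _ (integrable_norm s1) iC)) => //.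
    by apply/measurable_EFinP; exact: measurableT_comp.
  move=> z _ /=; rewrite lee_fin.
  rewrite [leRHS]ger0_norm ?addr_ge0//.
  have [[/= Uz Vz]|/(out _)[-> _]] := WP z; last by rewrite lerDl.
  have [h _ _] := inn _ Uz Vz.
  by apply: (le_trans h); rewrite (le_trans (ler_norm C))// lerDr.
have i2 : (P \x P).-integrable setT (EFin \o (s \o Psi)).
  apply: (le_integrable _ _ _ (integrableD _ (integrable_norm s2) iC)) => //.
    by apply/measurable_EFinP; exact: measurableT_comp.
  move=> z _ /=; rewrite lee_fin.
  rewrite [leRHS]ger0_norm ?addr_ge0//.
  have [[/= Uz Vz]|/(out _)[_ ->]] := WP z; last by rewrite lerDl.
  have [_ h _] := inn _ Uz Vz.
  by apply: (le_trans h); rewrite (le_trans (ler_norm C))// lerDr.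
rewrite integral_mean_law// -integralD//.
have low : \int[P]_x (s x)%:E + \int[P]_x (s x)%:E + del%:E * (P U * P V) <=
    \int[P \x P]_z ((s (Phi z))%:E + (s (Psi z))%:E).
  rewrite -{1}s1E -s2E -integralD//.
  have -> : P U * P V = \int[P \x P]_z (\1_W z)%:E.
    rewrite integral_indic// setIT; exact/esym/product_measure1E.
  rewrite -integralZl// -integralD//; last 2 first.
  - exact: integrableD.
  - exact: integrableZl.
  apply: le_integral => //=.
  - by apply: integrableD => //; [exact: integrableD|exact: integrableZl].
  - exact: integrableD.
  - move=> z _; rewrite -EFinM -!EFinD lee_fin indicE.
    have [[/= Uz Vz]|nW] := WP z.
      have -> : z \in W by rewrite inE.
      by rewrite mulr1; have [] := inn _ Uz Vz.
    have [-> ->] := out _ nW.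
    have -> : (z \in W) = false by apply/negP; rewrite inE.
    by rewrite mulr0 addr0.
have Ifin : \int[P]_x (s x)%:E \is a fin_num by exact: integrable_fin_num.
(* Half of [low] is the integral of [s] plus half of [del * (P U * P V)]; all terms are finite, so
   the inequality is strict. *)
apply: (lt_le_trans _ (lee_wpmul2l _ low)); last by rewrite lee_fin.
have : 0 < P U * P V by exact: mule_gt0.
have : P U * P V \is a fin_num by rewrite fin_numM// fin_num_measure.
move=> /fineK <-; rewrite -(fineK Ifin) -EFinM !lte_fin.
set w := fine _; set I := fine _ => w0.
have dw : (0 < del * w)%R by exact: mulr_gt0.
lra.
Qed.

End mean_law.

(** * Borel measurability of coordinate exchanges *)

Section borel.
Context {R : realType}.

Lemma open_measurable_borel (T : normedModType R) (A : set T) :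
  open A -> measurable (A : set (borel T)).
Proof. exact: sub_sigma_algebra. Qed.

Lemma continuous_measurable_borel (T : normedModType R) (f : T -> R) :
  continuous f -> measurable_fun (setT : set (borel T)) f.
Proof.
move=> /continuousP cf.
apply: (measurability _ (RGenOpens.measurableE R)) => //.
move=> _ [_ [a [b ->] <-]]; rewrite setTI.
by apply: open_measurable_borel; apply: cf; exact: interval_open.
Qed.

Lemma continuous_measurable_preimage (T T' : normedModType R) (f : T -> T')
    (E : set (borel T')) :
  continuous f -> measurable E -> measurable (f @^-1` E : set (borel T)).
Proof.
move=> /continuousP cf mE; rewrite -[X in measurable X]setTI.
apply: (@measurability _ _ (borel T) (borel T') setT f (@open T')) => //.
move=> _ [B oB <-]; rewrite setTI.
by apply: open_measurable_borel; exact: cf.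
Qed.

Lemma ball_rat_rV n (x : 'rV[R]_n) (e : R) : 0 < e ->
  exists c : 'rV[rat]_n, ball x e (map_mx ratr c).
Proof.
move=> e0.
have h j : exists q : rat, `|x 0 j - ratr q| < e.
  have [|q] := @rat_in_itvoo R (x 0 j - e) (x 0 j + e); first by lra.
  rewrite in_itv/= => /andP[? ?]; exists q.
  by rewrite ltr_norml; apply/andP; split; lra.
have [q hq] := choice h.
exists (\row_j q j); split=> // i j; rewrite !mxE !ord1.
exact: hq.
Qed.

Definition rat_triple n (c : rat * 'rV[rat]_n * 'rV[rat]_n) :
    triple_space R n :=
  (ratr c.1.1, map_mx ratr c.1.2, map_mx ratr c.2).

Lemma ball_rat_triple n (x : triple_space R n) (e : R) : 0 < e ->
  exists c, ball x e (rat_triple c).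
Proof.
move=> e0; have [q] := @rat_in_itvoo R (x.1.1 - e) (x.1.1 + e) ltac:(lra).
rewrite in_itv/= => /andP[q1 q2].
have [c1 h1] := ball_rat_rV x.1.2 e0; have [c2 h2] := ball_rat_rV x.2 e0.
exists (q, c1, c2); split => //; split => //=.
by rewrite /ball/= ltr_norml; apply/andP; split; lra.
Qed.

(** Second countability with an explicit base; the index type is countable, so preimages of open
    sets can be measured ball by ball. *)
Lemma open_bigcup_rat_ball n (O : set (triple_space R n)) : open O ->
  O = \bigcup_(i : {i : rat * 'rV[rat]_n * 'rV[rat]_n * nat |
                    `[< ball (rat_triple i.1) i.2.+1%:R^-1 `<=` O >]})
        ball (rat_triple (val i).1) (val i).2.+1%:R^-1.
Proof.
move=> oO; apply/seteqP; split=> [x Ox|x [[i /= /asboolP iO] _]];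
  last exact: iO.
have /nbhs_ballP[e/= e0 eO] : nbhs x O by exact: open_nbhs_nbhs.
(* A radius below [e / 2] keeps a ball that contains [x] inside the ball of radius [e] around
   [x]. *)
have [k ke] : exists k : nat, k.+1%:R^-1 < e / 2.
  have [k _ /(_ k (leqnn k)) ke] :=
    near_infty_natSinv_lt (PosNum (divr_gt0 e0 (ltr0n R 2))).
  by exists k.
have k0 : 0 < k.+1%:R^-1 :> R by rewrite invr_gt0.
have [c xc] := ball_rat_triple x k0.
have cO : ball (rat_triple c) k.+1%:R^-1 `<=` O.
  move=> y cy; apply: eO; rewrite (splitr e).
  apply: (@ball_triangle _ _ (rat_triple c)).
    by apply: le_ball xc; exact: ltW.
  by apply: le_ball cy; exact: ltW.
exists (exist _ (c, k) (asboolT cO)) => //=; exact: ball_sym.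
Qed.

(** Balls of the product are boxes, so the preimage of a rational ball is an intersection of three
    coordinate conditions. *)
Lemma measurable_fun_triple n d (Z : measurableType d)
    (f : Z -> triple_space R n) :
  (forall A : set R, open A -> measurable [set z | A (f z).1.1]) ->
  (forall A : set 'rV[R]_n, open A -> measurable [set z | A (f z).1.2]) ->
  (forall A : set 'rV[R]_n, open A -> measurable [set z | A (f z).2]) ->
  measurable_fun setT (f : Z -> borel (triple_space R n)).
Proof.
move=> m0 m1 m2.
apply: (@measurability _ _ Z (borel (triple_space R n)) setT f
          (@open (triple_space R n))) => //.
move=> _ [B oB <-]; rewrite setTI (open_bigcup_rat_ball oB) preimage_bigcup.
apply: countable_bigcupT_measurable => // -[[c k] /= _].
have -> : f @^-1` ball (rat_triple c) k.+1%:R^-1 =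
  [set z | ball (rat_triple c).1.1 k.+1%:R^-1 (f z).1.1] `&`
  [set z | ball (rat_triple c).1.2 k.+1%:R^-1 (f z).1.2] `&`
  [set z | ball (rat_triple c).2 k.+1%:R^-1 (f z).2].
  by apply/seteqP; split=> z /= [[]].
have k0 : 0 < k.+1%:R^-1 :> R by rewrite invr_gt0.
by apply: measurableI; [apply: measurableI; [apply: m0|apply: m1]|apply: m2];
  exact: ball_open.
Qed.

Definition swap n (i0 i1 i2 : bool) (z : triple_space R n * triple_space R n) :
    triple_space R n :=
  (if i0 then z.2.1.1 else z.1.1.1, if i1 then z.2.1.2 else z.1.1.2,
   if i2 then z.2.2 else z.1.2).

(** The source carries the product of two Borel sigma-algebras, so measurability is not read off
    from continuity; instead, each coordinate of the result comes from just one of the two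
    points. *)
Lemma measurable_swap n i0 i1 i2 :
  measurable_fun setT (swap i0 i1 i2 :
    borel (triple_space R n) * borel (triple_space R n) ->
    borel (triple_space R n)).
Proof.
have m12 (B : set (triple_space R n)) (i : bool) : open B ->
    measurable [set z : borel (triple_space R n) * borel (triple_space R n) |
                  B (if i then z.2 else z.1)].
  move=> oB; have mB := open_measurable_borel oB.
  rewrite -[X in measurable X]setTI.
  by case: i; [exact: measurable_snd|exact: measurable_fst].
apply: measurable_fun_triple => A oA /=.
- pose B : set (triple_space R n) := [set x | A x.1.1].
  have oB : open B.
    apply: (@open_comp _ _ (fun x : triple_space R n => x.1.1)) => // x _.
    by apply: cvg_comp; [exact: cvg_fst|exact: cvg_fst].
  have := m12 B i0 oB; congr measurable.
  by apply/funext => z; rewrite /B /=; case: (i0).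
- pose B : set (triple_space R n) := [set x | A x.1.2].
  have oB : open B.
    apply: (@open_comp _ _ (fun x : triple_space R n => x.1.2)) => // x _.
    by apply: cvg_comp; [exact: cvg_fst|exact: cvg_snd].
  have := m12 B i1 oB; congr measurable.
  by apply/funext => z; rewrite /B /=; case: (i1).
- pose B : set (triple_space R n) := [set x | A x.2].
  have oB : open B.
    apply: (@open_comp _ _ (fun x : triple_space R n => x.2)) => // x _.
    exact: cvg_snd.
  have := m12 B i2 oB; congr measurable.
  by apply/funext => z; rewrite /B /=; case: (i2).
Qed.

Lemma continuous_pair (T U V : topologicalType) (f : T -> U) (g : T -> V) :
  continuous f -> continuous g -> continuous (fun x => (f x, g x)).
Proof.
move=> cf cg x; apply: (@cvg_pair _ _ _ _ (nbhs (f x)) (nbhs (g x))).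
  exact: cf.
exact: cg.
Qed.

Lemma continuous_compT (U V W : topologicalType) (f : U -> V) (g : V -> W) :
  continuous f -> continuous g -> continuous (g \o f).
Proof. by move=> cf cg z; apply: continuous_comp; [exact: cf|exact: cg]. Qed.

Lemma continuous_swap n i0 i1 i2 : continuous (@swap n i0 i1 i2).
Proof.
have cfst (U V : topologicalType) : continuous (@fst U V).
  by move=> z; exact: cvg_fst.
have csnd (U V : topologicalType) : continuous (@snd U V).
  by move=> z; exact: cvg_snd.
have comp := @continuous_compT.
apply: continuous_pair; [apply: continuous_pair|].
- case: i0.
    exact: (comp _ _ _ snd _ (csnd _ _) (comp _ _ _ _ _ (cfst _ _) (cfst _ _))).
  exact: (comp _ _ _ fst _ (cfst _ _) (comp _ _ _ _ _ (cfst _ _) (cfst _ _))).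
- case: i1.
    exact: (comp _ _ _ snd _ (csnd _ _) (comp _ _ _ _ _ (cfst _ _) (csnd _ _))).
  exact: (comp _ _ _ fst _ (cfst _ _) (comp _ _ _ _ _ (cfst _ _) (csnd _ _))).
- case: i2.
    exact: (comp _ _ _ snd _ (csnd _ _) (csnd _ _)).
  exact: (comp _ _ _ fst _ (cfst _ _) (csnd _ _)).
Qed.

End borel.

Lemma mfun_exists d d' (T : measurableType d) (T' : measurableType d')
    (f : T -> T') : measurable_fun setT f ->
  exists F : {mfun T >-> T'}, forall z, F z = f z.
Proof.
move=> mf; pose m := isMeasurableFun.Build _ _ _ _ _ mf.
by exists (MeasurableFun.Pack (MeasurableFun.Class m)).
Qed.

(** * Monotonicity of the surplus on the support *)

Section monotone.
Context {R : realType} (n : nat).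
Local Notation T := (triple_space R n).
Implicit Type pi : probability (borel T) R.

Lemma continuous_surplus (b : pair_space R n -> R) :
  continuous b -> continuous (surplus b).
Proof.
move=> cb x.
apply: (@continuousM _ _ (fun x : T => x.1.1) (fun x : T => b (x.1.2, x.2))).
  by apply: cvg_comp; exact: cvg_fst.
apply: (@continuous_comp _ _ _ (fun x : T => (x.1.2, x.2)) b); last exact: cb.
apply: continuous_pair; move=> z; last exact: cvg_snd.
by apply: cvg_comp; [exact: cvg_fst|exact: cvg_snd].
Qed.

Lemma swap_product_domain (X1 X2 : set 'rV[R]_n) i0 i1 i2 (z : T * T) :
  product_domain X1 X2 z.1 -> product_domain X1 X2 z.2 ->
  product_domain X1 X2 (swap i0 i1 i2 z).
Proof.
by move=> [? ? ?] [? ? ?]; split => /=; [case: i0|case: i1|case: i2].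
Qed.

(** Complementary flags give the other point of the exchanged pair. The exchange
    is performed only on [U `*` V], where it will be profitable. *)
Definition partial_swap (U V : set T) i0 i1 i2 (z : T * T) : T * T :=
  if (z.1 \in U) && (z.2 \in V)
  then (swap i0 i1 i2 z, swap (~~ i0) (~~ i1) (~~ i2) z) else z.

Lemma measurable_partial_swap (U V : set (borel T)) i0 i1 i2 :
  measurable U -> measurable V ->
  measurable_fun setT
    (fun z : borel T * borel T => (partial_swap U V i0 i1 i2 z).1 : borel T) /\
  measurable_fun setT
    (fun z : borel T * borel T => (partial_swap U V i0 i1 i2 z).2 : borel T).
Proof.
move=> mU mV.
have mUV : measurable_fun setT
    (fun z : borel T * borel T => (z.1 \in U) && (z.2 \in V)).
  have m1 : measurable_fun setT (fun z : borel T => z \in U).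
    apply: (measurable_fun_bool true); rewrite setTI.
    rewrite (_ : _ @^-1` _ = U)//; apply/seteqP; split=> x /=.
      exact: set_mem.
    exact: mem_set.
  have m2 : measurable_fun setT (fun z : borel T => z \in V).
    apply: (measurable_fun_bool true); rewrite setTI.
    rewrite (_ : _ @^-1` _ = V)//; apply/seteqP; split=> x /=.
      exact: set_mem.
    exact: mem_set.
  apply: measurable_and.
    exact: (measurableT_comp m1 (@measurable_fst _ _ (borel T) (borel T))).
  exact: (measurableT_comp m2 (@measurable_snd _ _ (borel T) (borel T))).
split.
  have := measurable_fun_ifT mUV (@measurable_swap R n i0 i1 i2)
    (@measurable_fst _ _ (borel T) (borel T)).
  by congr measurable_fun; apply/funext => z; rewrite /partial_swap; case: ifP.
have := measurable_fun_ifT mUV (@measurable_swap R n (~~ i0) (~~ i1) (~~ i2))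
  (@measurable_snd _ _ (borel T) (borel T)).
by congr measurable_fun; apply/funext => z; rewrite /partial_swap; case: ifP.
Qed.

(** If an exchange raised the total at [(p, q)], continuity would give a uniform gain on a product
    of open neighbourhoods, each of positive mass because [p] and [q] lie in the support. The
    averaged law of the exchanged points would then be a coupling with a larger integral. *)
Lemma surplus_monotone (b : pair_space R n -> R) (X1 X2 : set 'rV[R]_n)
    mu0 mu1 mu2 pi (p q : T) i0 i1 i2 : continuous b ->
  maximizes b (couplings X1 X2 mu0 mu1 mu2) pi ->
  support_in pi (product_domain X1 X2) p ->
  support_in pi (product_domain X1 X2) q ->
  surplus b (swap i0 i1 i2 (p, q)) +
    surplus b (swap (~~ i0) (~~ i1) (~~ i2) (p, q)) <=
  surplus b p + surplus b q.
Proof.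
move=> cb [[piX pi0 pi1 pi2] si maxi] [Xp Up] [Xq Uq].
have cs := continuous_surplus cb.
pose F1 z := surplus b (swap i0 i1 i2 z).
pose F2 z := surplus b (swap (~~ i0) (~~ i1) (~~ i2) z).
have cF1 : continuous F1.
  exact: (@continuous_compT _ _ _ (@swap R n i0 i1 i2) (surplus b)
            (@continuous_swap R n i0 i1 i2) cs).
have cF2 : continuous F2.
  exact: (@continuous_compT _ _ _ (@swap R n (~~ i0) (~~ i1) (~~ i2))
            (surplus b) (@continuous_swap R n _ _ _) cs).
have cG1 : continuous (fun z : T * T => surplus b z.1).
  by apply: (@continuous_compT _ _ _ fst _ _ cs) => z; exact: cvg_fst.
have cG2 : continuous (fun z : T * T => surplus b z.2).
  by apply: (@continuous_compT _ _ _ snd _ _ cs) => z; exact: cvg_snd.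
rewrite leNgt; apply/negP => gain.
pose D z := F1 z + F2 z - (surplus b z.1 + surplus b z.2).
have cD : continuous D.
  move=> z; exact: (continuousB (continuousD (cF1 z) (cF2 z))
                                (continuousD (cG1 z) (cG2 z))).
have D0 : 0 < D (p, q) by rewrite /D /F1 /F2 /=; lra.
pose del := D (p, q) / 2; pose C := `|F1 (p, q)| + `|F2 (p, q)| + 1.
have : nbhs (p, q) [set z | [/\ `|F1 z| <= C, `|F2 z| <= C & del <= D z]].
  have n1 : \forall z \near nbhs (p, q), `|F1 z| <= C.
    apply: (@cvgr_norm_le _ _ _ _ _ F1 (F1 (p, q))); first exact: cF1.
    by rewrite /C; have := normr_ge0 (F2 (p, q)); lra.
  have n2 : \forall z \near nbhs (p, q), `|F2 z| <= C.
    apply: (@cvgr_norm_le _ _ _ _ _ F2 (F2 (p, q))); first exact: cF2.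
    by rewrite /C; have := normr_ge0 (F1 (p, q)); lra.
  have n3 : \forall z \near nbhs (p, q), del <= D z.
    by apply: (@cvgr_ge _ _ _ _ D (D (p, q)) (cD _)); rewrite /del; lra.
  by apply: filterS3 n1 n2 n3 => z; split.
case=> -[A B] [/= nA nB] AB.
pose U : set T := A°; pose V : set T := B°.
have mU := open_measurable_borel (@open_interior _ A).
have mV := open_measurable_borel (@open_interior _ B).
have [mPhi mPsi] := measurable_partial_swap i0 i1 i2 mU mV.
have [Phi PhiE] := mfun_exists mPhi; have [Psi PsiE] := mfun_exists mPsi.
rewrite -/U -/V in mU mV mPhi mPsi PhiE PsiE.
have UV z : (partial_swap U V i0 i1 i2 z) =
    if (z.1 \in U) && (z.2 \in V)
    then (swap i0 i1 i2 z, swap (~~ i0) (~~ i1) (~~ i2) z) else z by [].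
have mpre (F : {mfun (borel T * borel T)%type >-> borel T})
    (E : set (borel T)) : measurable E -> measurable (F @^-1` E).
  by move=> mE; rewrite -[X in measurable X]setTI; exact: measurable_funP.
(* With complementary flags, each coordinate of the two new points is the old pair of coordinates in
   some order, which is the counting condition for the marginals. *)
have coup : couplings X1 X2 mu0 mu1 mu2 (mean_law pi Phi Psi).
  split.
  - move=> E mE XE; apply: mean_law_eq1.
      apply: (@product_full _ _ _ pi (product_domain X1 X2)) => //;
        first exact: mpre.
      move=> z [/= z1 z2]; rewrite PhiE UV; case: ifP => _; apply: XE => //.
      exact: swap_product_domain.
    apply: (@product_full _ _ _ pi (product_domain X1 X2)) => //;
        first exact: mpre.
    move=> z [/= z1 z2]; rewrite PsiE UV; case: ifP => _; apply: XE => //.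
    exact: swap_product_domain.
  - move=> E mE; rewrite -pi0//; apply: mean_law_marginal.
      rewrite -[X in measurable X]setTI.
      apply: (continuous_measurable_borel (f := fun x : T => x.1.1)) => //.
      by apply: (@continuous_compT _ _ _ fst fst) => z; exact: cvg_fst.
    have mE1 x : (x \in [set x : T | E x.1.1]) = (x.1.1 \in E).
      by apply/idP/idP; rewrite !inE.
    move=> z; rewrite PhiE PsiE !mE1 UV; case: ifP => // _ /=.
    by case: (i0) => //=; rewrite addnC.
  - move=> E mE; rewrite -pi1//; apply: mean_law_marginal.
      apply: (continuous_measurable_preimage (f := fun x : T => x.1.2)) => //.
      apply: (@continuous_compT _ _ _ fst snd) => z; first exact: cvg_fst.
      exact: cvg_snd.
    have mE1 x : (x \in [set x : T | E x.1.2]) = (x.1.2 \in E).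
      by apply/idP/idP; rewrite !inE.
    move=> z; rewrite PhiE PsiE !mE1 UV; case: ifP => // _ /=.
    by case: (i1) => //=; rewrite addnC.
  - move=> E mE; rewrite -pi2//; apply: mean_law_marginal.
      apply: (continuous_measurable_preimage (f := fun x : T => x.2)) => //.
      by move=> z; exact: cvg_snd.
    have mE1 x : (x \in [set x : T | E x.2]) = (x.2 \in E).
      by apply/idP/idP; rewrite !inE.
    move=> z; rewrite PhiE PsiE !mE1 UV; case: ifP => // _ /=.
    by case: (i2) => //=; rewrite addnC.
have := maxi _ coup; rewrite leNgt => /negP; apply.
apply: (@swap_gain _ _ _ pi Phi Psi (surplus b) U V C del) => //.
- apply: Up; [exact: open_interior|exact: nA].
- apply: Uq; [exact: open_interior|exact: nB].
- by rewrite /del; lra.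
- move=> z nz; rewrite PhiE PsiE UV; case: ifP => //.
  by move=> /andP[/set_mem z1 /set_mem z2]; case: nz.
- move=> z z1 z2; rewrite PhiE PsiE UV !mem_set//=.
  have [//|h1 h2 h3] := AB z; first by split; exact: interior_subset.
  by split=> //; move: h3; rewrite /D /F1 /F2; lra.
Qed.

End monotone.

(** * Second-order expansion of the surplus *)

Section lines.
Context {R : realType}.
Implicit Types V : normedModType R.

Lemma is_derive_line V (f : V -> R) (p v : V) (t : R) :
  differentiable f (p + t *: v) ->
  is_derive t 1 (fun t => f (p + t *: v)) ('D_v f (p + t *: v)).
Proof.
move=> df.
have E : (fun h : R => h^-1 *: (((fun t => f (p + t *: v)) \o shift t) (h *: 1)
            - f (p + t *: v))) =
         (fun h => h^-1 *:
            ((f \o shift (p + t *: v)) (h *: v) - f (p + t *: v))).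
  apply/funext => h /=; congr (_ *: (f _ - _)).
  by rewrite -[h *: 1]mulr1 mulr1 [h *: 1]mulr1 scalerDl addrCA.
have dv : derivable f (p + t *: v) v by exact: diff_derivable.
split; first by rewrite /derivable E.
by rewrite /derive E.
Qed.

Lemma MVT_line V (f : V -> R) (p v : V) : (forall x, differentiable f x) ->
  exists2 t, 0 <= t <= 1 & f (p + v) - f p = 'D_v f (p + t *: v).
Proof.
move=> df; have isd (t : R) := is_derive_line (df (p + t *: v)).
have cf : {within `[0, 1], continuous (fun t : R => f (p + t *: v))}.
  apply: continuous_subspaceT => t; apply: differentiable_continuous.
  by apply/derivable1_diffP; have [] := isd t.
have [t] := MVT_segment ler01 (fun t _ => isd t) cf.
by rewrite in_itv/= scale1r scale0r addr0 subr0 mulr1 => ? ?; exists t.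
Qed.

(** The mean value theorem twice: along [v] for the difference of [f] between the lines through
    [p + w] and [p], then along [w] for ['D_v f]. *)
Lemma MVT_line2 V (f : V -> R) (p v w : V) : (forall x, differentiable f x) ->
  (forall x, differentiable ('D_v f) x) ->
  exists s t, [/\ 0 <= s <= 1, 0 <= t <= 1 &
    f (p + v + w) - f (p + v) - (f (p + w) - f p) =
    'D_w ('D_v f) (p + t *: v + s *: w)].
Proof.
move=> df ddf.
have isd (q : V) (t : R) := is_derive_line (df (q + t *: v)).
pose g (t : R) := f (p + w + t *: v) - f (p + t *: v).
have isg (t : R) : is_derive t 1 g
    ('D_v f (p + w + t *: v) - 'D_v f (p + t *: v)).
  exact: is_deriveB.
have cg : {within `[0, 1], continuous g}.
  apply: continuous_subspaceT => t; apply: differentiable_continuous.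
  by apply/derivable1_diffP; have [] := isg t.
have [t] := MVT_segment ler01 (fun t _ => isg t) cg.
rewrite in_itv/= /g !scale1r !scale0r !addr0 subr0 mulr1 => t01 E.
have [s s01 F] := MVT_line (p + t *: v) w ddf.
exists s, t; split=> //; rewrite -F.
rewrite -[p + t *: v + w]addrAC -E.
by rewrite [p + w + v]addrAC; lra.
Qed.

(** Balls are convex, so the intermediate points of the mean value theorem stay near the base
    point. *)
Lemma ball_segment V (c p v : V) (d t : R) : 0 <= t <= 1 ->
  ball c d p -> ball c d (p + v) -> ball c d (p + t *: v).
Proof.
have -> : p + t *: v = (1 - t) *: p + t *: (p + v).
  by rewrite scalerBl scale1r scalerDr addrA subrK.
rewrite -ball_normE /= => /andP[t0 t1] h0 h1.
have -> : c - ((1 - t) *: p + t *: (p + v)) =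
          (1 - t) *: (c - p) + t *: (c - (p + v)).
  by rewrite 2!scalerBr addrACA -scalerDl subrK scale1r opprD.
apply: (le_lt_trans (ler_normD _ _)); rewrite !normrZ !ger0_norm ?subr_ge0//.
by have [h|h] := leP `|c - p| `|c - (p + v)|; nra.
Qed.

End lines.

(** * Directional derivatives through gradients and the mixed Hessian *)

Section gradients.
Context {R : realType}.

Lemma rV_pair_decomp k m (v : 'rV[R]_k * 'rV[R]_m) :
  v = \sum_r v.1 0 r *: (delta_mx 0 r, 0) + \sum_l v.2 0 l *: (0, delta_mx 0 l).
Proof.
have E1 h (F : 'I_h -> 'rV[R]_k * 'rV[R]_m) : (\sum_i F i).1 = \sum_i (F i).1.
  by apply: (big_morph fst).
have E2 h (F : 'I_h -> 'rV[R]_k * 'rV[R]_m) : (\sum_i F i).2 = \sum_i (F i).2.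
  by apply: (big_morph snd).
have P (a c : 'rV[R]_k * 'rV[R]_m) : a.1 = c.1 -> a.2 = c.2 -> a = c.
  by case: a c => [? ?] [? ?] /= -> ->.
apply: P; rewrite /= ?E1 ?E2 /=.
  rewrite [X in _ + X]big1 ?addr0; first exact: row_sum_delta.
  by move=> l _; rewrite scaler0.
rewrite [X in X + _]big1 ?add0r; first exact: row_sum_delta.
by move=> l _; rewrite scaler0.
Qed.

Variable n : nat.
Implicit Types (b : pair_space R n -> R) (x v : pair_space R n).

Lemma derive_grad b x v : differentiable b x ->
  'D_v b x = (v.1 *m (grad1 b x)^T) 0 0 + (v.2 *m (grad2 b x)^T) 0 0.
Proof.
have vE : v = \sum_r v.1 0 r *: e1 r + \sum_l v.2 0 l *: e2 l.
  exact: rV_pair_decomp.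
move=> db; rewrite deriveE// {1}vE linearD !linear_sum.
congr (_ + _); rewrite [RHS]mxE; apply: eq_bigr => r _;
  by rewrite linearZ /= -deriveE// !mxE.
Qed.

Lemma derive_mixed b x (u w : 'rV[R]_n) : (forall y, differentiable b y) ->
  (forall r y, differentiable ('D_(e1 r) b) y) ->
  'D_(0, w) ('D_(u, 0) b) x = (u *m mixed_hessian b x *m w^T) 0 0.
Proof.
move=> db ddb.
have -> : 'D_(u, 0) b = \sum_r (u 0 r \*: 'D_(e1 r) b).
  apply/funext => y; rewrite derive_grad//= mul0mx [in X in _ + X]mxE addr0.
  rewrite mxE fct_sumE; by apply: eq_bigr => r _; rewrite !mxE.
rewrite derive_sum; last first.
  by move=> r; apply: derivableZ; apply: diff_derivable; exact: ddb.
rewrite -mulmxA mxE; apply: eq_bigr => r _.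
rewrite deriveZ; last by apply: diff_derivable; exact: ddb.
rewrite derive_grad//= mul0mx [in X in X + _]mxE add0r; congr (_ * _).
by rewrite !mxE; apply: eq_bigr => l _; rewrite !mxE mulrC.
Qed.

End gradients.

(** * Error estimates near the base point *)

Section estimates.
Context {R : realType}.

Lemma coord_le_norm m n (A : 'M[R]_(m, n)) i j : `|A i j| <= `|A|.
Proof.
rewrite -[`|A|]/(mx_norm A) mx_normrE.
exact: (le_bigmax _ (fun ij => `|A ij.1 ij.2|) (i, j)).
Qed.

(** Row vectors carry the sup norm, whence the factor [n], the number of terms. *)
Lemma dot_bound n (u v : 'rV[R]_n) (a c : R) :
  (forall r, `|u 0 r| <= a) -> (forall r, `|v 0 r| <= c) ->
  `|(u *m v^T) 0 0| <= n%:R * (a * c).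
Proof.
move=> ua vc; rewrite mxE; apply: (le_trans (ler_norm_sum _ _ _)).
have -> : n%:R * (a * c) = \sum_(r < n) (a * c).
  by rewrite sumr_const card_ord mulr_natl.
by apply: ler_sum => r _; rewrite mxE normrM ler_pM.
Qed.

Lemma bilinear_bound n (A : 'M[R]_n) (u v : 'rV[R]_n) (e : R) :
  (forall r l, `|A r l| <= e) ->
  `|(u *m A *m v^T) 0 0| <= n%:R * (n%:R * (`|u| * e) * `|v|).
Proof.
move=> Ae; apply: dot_bound => r; last exact: coord_le_norm.
have -> : (u *m A) 0 r = (u *m (col r A)^T^T) 0 0.
  by rewrite trmxK !mxE; apply: eq_bigr => l _; rewrite mxE.
apply: dot_bound => l; first exact: coord_le_norm.
by rewrite !mxE.
Qed.

Lemma C2_near n (b : pair_space R n -> R) (x : pair_space R n) (e : R) :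
  C2 b -> 0 < e -> exists2 d, 0 < d & forall y, ball x d y ->
    [/\ forall r l, `|(mixed_hessian b y - mixed_hessian b x) r l| <= e,
        forall r, `|(grad1 b y - grad1 b x) 0 r| <= e
      & forall r, `|(grad2 b y - grad2 b x) 0 r| <= e].
Proof.
move=> [[_ cb] c2b] e0.
have near_le (f : pair_space R n -> R) : continuous f ->
    \forall y \near x, `|f y - f x| <= e.
  move=> cf; have h : \forall y \near x, `|f x - f y| <= e.
    exact: (@cvgr_dist_le _ _ _ (nbhs x) _ f (f x) (cf x) e e0).
  by near=> y; rewrite distrC; near: y; exact: h.
have h0 : \forall y \near x, forall rl : 'I_n * 'I_n,
    `|(mixed_hessian b y - mixed_hessian b x) rl.1 rl.2| <= e.
  apply: (@filter_forall _ _ (fun rl y =>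
    `|(mixed_hessian b y - mixed_hessian b x) rl.1 rl.2| <= e) (nbhs x) _ _).
  move=> -[r l] /=.
  by apply: filterS (near_le _ ((c2b (e1 r)).2 (e2 l))) => y; rewrite !mxE.
have h1 : \forall y \near x, forall r, `|(grad1 b y - grad1 b x) 0 r| <= e.
  apply: (@filter_forall _ _
    (fun r y => `|(grad1 b y - grad1 b x) 0 r| <= e) (nbhs x) _ _) => r.
  by apply: filterS (near_le _ (cb (e1 r))) => y; rewrite !mxE.
have h2 : \forall y \near x, forall r, `|(grad2 b y - grad2 b x) 0 r| <= e.
  apply: (@filter_forall _ _
    (fun r y => `|(grad2 b y - grad2 b x) 0 r| <= e) (nbhs x) _ _) => r.
  by apply: filterS (near_le _ (cb (e2 r))) => y; rewrite !mxE.
have /nbhs_ballP[d /= d0 H] : nbhs x [set y | [/\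
    forall rl : 'I_n * 'I_n,
      `|(mixed_hessian b y - mixed_hessian b x) rl.1 rl.2| <= e,
    forall r, `|(grad1 b y - grad1 b x) 0 r| <= e
    & forall r, `|(grad2 b y - grad2 b x) 0 r| <= e]].
  by apply: filterS3 h0 h1 h2 => y; split.
exists d => // y /H [k0 k1 k2]; split=> // r l; exact: (k0 (r, l)).
Unshelve. all: by end_near. Qed.

Lemma triple_norm_ge n (D : triple_space R n) :
  [/\ `|D.1.1| <= `|D|, `|D.1.2| <= `|D| & `|D.2| <= `|D|].
Proof.
by rewrite prod_normE [`|D.1|]prod_normE /= !le_max !lexx ?orbT.
Qed.

(** The second mixed differences of the surplus [x0 b(x1,x2)] at a base point
    with first coordinate [a] are given by this form with [H] equal to [a]
    times the mixed Hessian of [b]. *)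
Definition cross_form n (H : 'M[R]_n) (g1 g2 : 'rV[R]_n)
    (D : triple_space R n) : R :=
  (D.1.2 *m H *m D.2^T) 0 0 +
  D.1.1 * ((D.1.2 *m g1^T) 0 0 + (D.2 *m g2^T) 0 0).

(** The exact inequality has derivatives at intermediate points in place of the base point;
    shrinking [N] makes the error at most [e |p - q|^2]. *)
Lemma support_spacelike n (b : pair_space R n -> R) (X1 X2 : set 'rV[R]_n)
    mu0 mu1 mu2 pi (a : R) (x1 x2 : 'rV[R]_n) (e : R) :
  C2 b -> maximizes b (couplings X1 X2 mu0 mu1 mu2) pi -> 0 < a -> 0 < e ->
  exists2 N, nbhs (a, x1, x2) N & forall p q,
    (support_in pi (product_domain X1 X2) `&` N) p ->
    (support_in pi (product_domain X1 X2) `&` N) q ->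
    - e * `|p - q| ^+ 2 <= cross_form (a *: mixed_hessian b (x1, x2))
                             (grad1 b (x1, x2)) (grad2 b (x1, x2)) (p - q).
Proof.
move=> b2 pimax a0 e0; set x := (x1, x2).
have [H HE] : exists H, H = mixed_hessian b x by exists (mixed_hessian b x).
have [g1 g1E] : exists g, g = grad1 b x by exists (grad1 b x).
have [g2 g2E] : exists g, g = grad2 b x by exists (grad2 b x).
rewrite -HE -g1E -g2E.
(* [c] adds up the error coefficients: [n^2] from the bilinear term, [2 n] from the gradients, and 1
   to keep it positive. An error [h] both in [x0] and in the Hessian changes their product by at
   most [(2 a + |H|) h <= s h = eta]. *)
pose c : R := n%:R * n%:R + 2 * n%:R + 1; pose s := 2 * a + `|H| + 1.
have n0 : 0 <= n%:R :> R by [].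
have c0 : 0 < c by rewrite /c; nra.
have s1 : 1 <= s by rewrite /s; have := normr_ge0 H; lra.
pose eta := e / c; have eta0 : 0 < eta by exact: divr_gt0.
have ce : c * eta = e by rewrite mulrC divfK// gt_eqF.
pose h := eta / s; have h0 : 0 < h by apply: divr_gt0 => //; lra.
have sh : s * h = eta by rewrite mulrC divfK// gt_eqF//; lra.
have h_eta : h <= eta by rewrite -sh; nra.
clearbody h; clearbody eta.
have [d d0 near_d] := C2_near x b2 h0.
have [[db _] ddb] := b2.
have cb : continuous b by move=> y; exact: differentiable_continuous.
(* [d] controls the derivatives, [h] the distance of [x0] to [a], and [a] keeps [x0] between 0 and
   [2 a]. *)
pose rad := Num.min d (Num.min h a).
exists (ball (a, x1, x2) rad).
  by apply: nbhsx_ballx; rewrite !lt_min d0 h0.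
move=> [[p0 p1] p2] [[q0 q1] q2] [Sp [[/= pa pd1] pd2]] [Sq [[/= qa qd1] qd2]].
have near_a y : ball a rad y -> - h <= y - a <= h /\ - a <= y - a <= a.
  rewrite /ball/= !lt_min => /and3P[_]; rewrite !ltr_norml => /andP[? ?].
  by move=> /andP[? ?]; split; apply/andP; split; lra.
have {pa}[pa1 pa2] := near_a _ pa; have {qa}[qa1 qa2] := near_a _ qa.
have sub (V : normedModType R) (u v : V) : ball u rad v -> ball u d v.
  by apply: le_ball; rewrite ge_min lexx.
have {}pd1 := sub _ _ _ pd1; have {}pd2 := sub _ _ _ pd2.
have {}qd1 := sub _ _ _ qd1; have {}qd2 := sub _ _ _ qd2.
have := surplus_monotone true false false cb pimax Sp Sq.
have := surplus_monotone false true false cb pimax Sp Sq.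
have := surplus_monotone false false true cb pimax Sp Sq.
rewrite /surplus/= => M2 M1 M0.
rewrite /cross_form /=.
set D := (_, _, _) - _; have [D0 D1 D2] := triple_norm_ge D.
set r := `|D| in D0 D1 D2 *.
pose u := p1 - q1; pose w := p2 - q2.
rewrite -/u -/w.
have {}D0 : `|p0 - q0| <= r by [].
have {}D1 : `|u| <= r by [].
have {}D2 : `|w| <= r by [].
have r0 : 0 <= r by exact: le_trans D1.
have mxB (A B : 'M[R]_1) : (A - B) 0 0 = A 0 0 - B 0 0 by rewrite !mxE.
have mxZ k (A : 'M[R]_1) : (k *: A) 0 0 = k * A 0 0 by rewrite mxE.
have trB (f g : 'rV[R]_n) : (f - g)^T = f^T - g^T by exact: linearB.
have pE : (q1, q2) + (u, w) = (p1, p2).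
  by congr pair; rewrite addrC subrK.
(* [A] is the mixed Hessian at an intermediate point, with first component between [q1] and [p1] and
   second between [q2] and [p2]. *)
have [A [EA nearA]] : exists A : 'M[R]_n,
    b (p1, p2) - b (p1, q2) - (b (q1, p2) - b (q1, q2)) =
      (u *m A *m w^T) 0 0 /\
    forall r l, `|(A - H) r l| <= h.
  have [t [t' [t01 t'01]]] :=
    MVT_line2 (q1, q2) (0, w) db (fun y => (ddb (u, 0)).1 y).
  rewrite derive_mixed//; last by move=> k; exact: (ddb (e1 k)).1.
  have -> : (q1, q2) + (u, 0) + (0, w) = (p1, p2).
    by rewrite -pE -addrA; congr (_ + (_, _)); rewrite /= ?addr0 ?add0r.
  have -> : (q1, q2) + (u, 0) = (p1, q2).
    rewrite -[LHS]/(q1 + u, q2 + 0) addr0 /u.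
    by rewrite [q1 + _]addrC subrK.
  have -> : (q1, q2) + (0, w) = (q1, p2).
    rewrite -[LHS]/(q1 + 0, q2 + w) addr0 /w.
    by rewrite [q2 + _]addrC subrK.
  set xi := (q1, q2) + t' *: _ + t *: _ => E.
  exists (mixed_hessian b xi); split=> //; rewrite HE.
  have [|//] := near_d xi.
  have -> : xi = (q1 + t' *: u, q2 + t *: w).
    by congr pair; rewrite /= ?scaler0 ?addr0.
  by split; apply: ball_segment => //=; rewrite /u /w addrC subrK.
have [h1 [h2 [Eh near1 near2]]] : exists h1 h2 : 'rV[R]_n, [/\
    b (p1, p2) - b (q1, q2) = (u *m h1^T) 0 0 + (w *m h2^T) 0 0,
    forall r, `|(h1 - g1) 0 r| <= eta & forall r, `|(h2 - g2) 0 r| <= eta].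
  have [t t01] := MVT_line (q1, q2) (u, w) db.
  rewrite pE derive_grad//=; set xi := (q1, q2) + _ => E.
  exists (grad1 b xi), (grad2 b xi); rewrite g1E g2E.
  have [|_ k1 k2] := near_d xi.
    by split; apply: ball_segment => //=; rewrite /u /w addrC subrK.
  split; first exact: E.
    by move=> k; exact: le_trans (k1 k) h_eta.
  by move=> k; exact: le_trans (k2 k) h_eta.
clear near_d.
(* In half the sum of the exchange inequalities, the mixed difference of [b] has as coefficient the
   midpoint of the two values of [x0]. *)
pose m := (p0 + q0) / 2; have mE : m + m = p0 + q0 by rewrite /m; lra.
have m2 : `|m| <= 2 * a by rewrite ler_norml /m; apply/andP; split; lra.
have ma : `|m - a| <= h by rewrite ler_norml /m; apply/andP; split; lra.
clearbody m.
have nearM k l : `|(m *: A - a *: H) k l| <= eta.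
  have -> : (m *: A - a *: H) k l = m * (A - H) k l + (m - a) * H k l.
    by rewrite !mxE; ring.
  apply: (le_trans (ler_normD _ _)); rewrite !normrM.
  have k1 := ler_pM (normr_ge0 _) (normr_ge0 _) m2 (nearA k l).
  have k2 := ler_pM (normr_ge0 _) (normr_ge0 _) ma (coord_le_norm H k l).
  by rewrite -sh /s; lra.
have := bilinear_bound u w nearM; rewrite mulmxBr mulmxBl mxB.
rewrite -scalemxAr -scalemxAl mxZ -EA.
have := dot_bound (coord_le_norm u 0) near1.
have := dot_bound (coord_le_norm w 0) near2.
rewrite !trB !mulmxBr !mxB.
move: Eh; set B1 := (u *m h1^T) 0 0; set B2 := (w *m h2^T) 0 0 => Eh.
set A1 := (u *m g1^T) 0 0; set A2 := (w *m g2^T) 0 0.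
set B := b (p1, p2) - _ - _; set Q := (u *m _ *m _) 0 0 => bw bu bB.
(* Half of [M0 + M1 + M2]. *)
have pos : 0 <= m * B + (p0 - q0) * (B1 + B2).
  have -> : p0 - q0 = 2 * (m - q0) by lra.
  by rewrite -Eh /B; have p0E : p0 = 2 * m - q0; [lra|subst p0; lra].
have bnd : n%:R * (n%:R * (`|u| * eta) * `|w|) <= n%:R * n%:R * eta * r ^+ 2.
  have -> : n%:R * (n%:R * (`|u| * eta) * `|w|) =
            (n%:R * n%:R * eta) * (`|u| * `|w|) by ring.
  apply: ler_wpM2l; last by rewrite expr2 ler_pM.
  by apply: mulr_ge0; [exact: mulr_ge0|exact: ltW].
have tri : `|B1 + B2 - (A1 + A2)| <= 2 * n%:R * eta * r.
  have -> : B1 + B2 - (A1 + A2) = (B1 - A1) + (B2 - A2) by ring.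
  apply: (le_trans (ler_normD _ _)); apply: (le_trans (lerD bu bw)).
  have ur : n%:R * (`|u| * eta) <= n%:R * (r * eta).
    by apply: ler_wpM2l => //; apply: ler_wpM2r => //; exact: ltW.
  have wr : n%:R * (`|w| * eta) <= n%:R * (r * eta).
    by apply: ler_wpM2l => //; apply: ler_wpM2r => //; exact: ltW.
  by apply: (le_trans (lerD ur wr)); lra.
have := ler_pM (normr_ge0 _) (normr_ge0 _) D0 tri.
rewrite -normrM ler_norml => /andP[_ dif].
move: bB; rewrite ler_norml => /andP[_ bB].
have er : 0 <= eta * r ^+ 2 by apply: mulr_ge0; [exact: ltW|exact: sqr_ge0].
(* The total error is at most [(n^2 + 2 n) eta r^2 <= c eta r^2 = e r^2]. *)
rewrite -ce /c; lra.
Qed.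

End estimates.

(** * Spacelike sets are Lipschitz graphs *)

Section cone.
Context {R : realType}.

Lemma mx_norm_le m n (A : 'M[R]_(m, n)) (a : R) : 0 <= a ->
  (forall i j, `|A i j| <= a) -> `|A| <= a.
Proof.
by move=> a0 Aa; rewrite -[`|A|]/(mx_norm A) mx_normrE; apply: bigmax_le.
Qed.

(** The extension is the lower envelope of the cones [x.2 + K |u - x.1|] with apex in [S]; the
    hypothesis, used in both orders of [x] and [y], is a Lipschitz bound. *)
Lemma mcshane (V : normedModType R) (S : set (V * R)) (K : R) : 0 <= K ->
  (forall x y, S x -> S y -> x.2 - y.2 <= K * `|x.1 - y.1|) ->
  exists f : V -> R, (forall u v, `|f u - f v| <= K * `|u - v|) /\
    forall x, S x -> f x.1 = x.2.
Proof.
move=> K0 SK; have [S0|/set0P[x0 Sx0]] := eqVneq S set0.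
  exists (fun=> 0); split=> [u v|x]; first by rewrite subrr normr0 mulr_ge0.
  by rewrite S0.
pose E u := [set x.2 + K * `|u - x.1| | x in S].
have E0 u : E u !=set0 by exists (x0.2 + K * `|u - x0.1|), x0.
have lb u : has_lbound (E u).
  exists (x0.2 - K * `|x0.1 - u|) => _ [y Sy <-].
  have := SK _ _ Sx0 Sy; have := ler_distD u x0.1 y.1.
  by move=> h1 h2; have := ler_wpM2l K0 h1; rewrite mulrDr; lra.
have leE u x : S x -> inf (E u) <= x.2 + K * `|u - x.1|.
  by move=> Sx; apply: ge_inf => //; exists x.
have lip u v : inf (E u) - inf (E v) <= K * `|u - v|.
  rewrite lerBlDr -lerBlDl; apply: lb_le_inf => // _ [y Sy <-].
  have h2 := leE u _ Sy; have h1 := ler_wpM2l K0 (ler_distD v u y.1).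
  by move: h1; rewrite mulrDr; lra.
exists (fun u => inf (E u)); split=> [u v|x Sx].
  rewrite ler_norml lip andbT lerNl opprB.
  by rewrite (le_trans (lip v u))// distrC.
apply/eqP; rewrite eq_le; apply/andP; split.
  by have := leE x.1 x Sx; rewrite subrr normr0 mulr0 addr0.
apply: lb_le_inf => // _ [y Sy <-].
by have := SK _ _ Sx Sy; lra.
Qed.

(** Each coordinate is extended separately; the sup norm on the target keeps the constant [K]. *)
Lemma mcshane_rV k m (S : set ('rV[R]_k * 'rV[R]_m)) (K : R) : 0 <= K ->
  (forall x y, S x -> S y -> `|x.2 - y.2| <= K * `|x.1 - y.1|) ->
  exists f : 'rV[R]_k -> 'rV[R]_m, lipschitz f /\ forall x, S x -> f x.1 = x.2.
Proof.
move=> K0 SK.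
have /choice[f fP] (j : 'I_m) : exists f : 'rV[R]_k -> R,
    (forall u v, `|f u - f v| <= K * `|u - v|) /\
    forall x, S x -> f x.1 = x.2 0 j.
  have [||f [lf Sf]] := @mcshane _ [set (x.1, x.2 0 j) | x in S] K.
  - exact: K0.
  - move=> _ _ [x Sx <-] [y Sy <-] /=; apply: le_trans (SK _ _ Sx Sy).
    apply: le_trans (coord_le_norm _ 0 j); rewrite !mxE; exact: ler_norm.
  - by exists f; split=> // x Sx; apply: (Sf (x.1, x.2 0 j)); exists x.
exists (fun u => \row_j f j u); split=> [|x Sx]; last first.
  by apply/rowP => j; rewrite mxE (fP j).2.
have T0 : ([set: 'rV[R]_k] `*` [set: 'rV[R]_k]) (0, 0) by [].
apply: (@klipschitzW _ _ _ K _ _ (globally_properfilter T0)) => -[u v] _ /=.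
apply: mx_norm_le => [|i j]; first by rewrite mulr_ge0.
by rewrite !mxE; exact: (fP j).1.
Qed.

Lemma graph_submanifold (V : normedModType R) k m
    (L : {linear ('rV[R]_k * 'rV[R]_m)%type -> V}) (f : 'rV[R]_k -> 'rV[R]_m) :
  bijective L -> lipschitz f ->
  lipschitz_submanifold k (range (fun u => L (u, f u))).
Proof.
move=> Lb fl p _; exists m, L, f, setT; split=> //; exact: filterT.
Qed.

Lemma linear_exists (U V : lmodType R) (f : U -> V) : linear f ->
  exists L : {linear U -> V}, forall x, L x = f x.
Proof.
move=> lf; pose m := GRing.isLinear.Build R U V _ f lf.
by exists (HB.pack f m : {linear U -> V}).
Qed.

Lemma linear_rV_bounded (V : normedModType R) k m
    (L : {linear ('rV[R]_k * 'rV[R]_m)%type -> V}) :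
  exists2 C, 0 <= C & forall d, `|L d| <= C * `|d|.
Proof.
exists (\sum_r `|L (delta_mx 0 r, 0)| + \sum_l `|L (0, delta_mx 0 l)|).
  by rewrite addr_ge0// sumr_ge0.
move=> d; have [d1 d2] : `|d.1| <= `|d| /\ `|d.2| <= `|d|.
  by rewrite prod_normE !le_max !lexx orbT.
rewrite {1}(rV_pair_decomp d) linearD !linear_sum.
apply: (le_trans (ler_normD _ _)); rewrite mulrDl; apply: lerD.
  apply: (le_trans (ler_norm_sum _ _ _)); rewrite mulr_suml.
  apply: ler_sum => r _; rewrite linearZ/= normrZ mulrC ler_wpM2l//.
  exact: le_trans (coord_le_norm _ _ _) d1.
apply: (le_trans (ler_norm_sum _ _ _)); rewrite mulr_suml.
apply: ler_sum => r _; rewrite linearZ/= normrZ mulrC ler_wpM2l//.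
exact: le_trans (coord_le_norm _ _ _) d2.
Qed.

(** The error [e |L d|^2] is absorbed by half of the negative term and a multiple of [|d.1|^2].
    Differences in [S] thus satisfy [|d.2| <= K |d.1|], so [S] is part of a Lipschitz graph over the
    first [k] coordinates. *)
Lemma spacelike_submanifold (V : normedModType R) k m
    (L : {linear ('rV[R]_k * 'rV[R]_m)%type -> V}) (q : V -> R) (A c : R) :
  bijective L -> 0 <= A -> 0 < c ->
  (forall d, q (L d) <= A * `|d.1| ^+ 2 - c * `|d.2| ^+ 2) ->
  exists2 e, 0 < e & forall S : set V,
    (forall x y, S x -> S y -> - e * `|x - y| ^+ 2 <= q (x - y)) ->
    exists2 M, lipschitz_submanifold k M & S `<=` M.
Proof.
move=> Lb A0 c0 qL; have [C C0 LC] := linear_rV_bounded L.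
(* Chosen so that [e C^2 <= c / 2]; the added 1 covers [C = 0]. *)
pose e := c / (2 * (C ^+ 2 + 1)).
have C1 : 0 < 2 * (C ^+ 2 + 1) by have := sqr_ge0 C; lra.
have e0 : 0 < e by exact: divr_gt0.
have eC : e * C ^+ 2 <= c / 2.
  have <- : e * (C ^+ 2 + 1) = c / 2.
    by rewrite /e; field; rewrite gt_eqF//; have := sqr_ge0 C; lra.
  by rewrite ler_wpM2l// ?ltW//; lra.
(* Absorption gives [|d.2|^2 <= K |d.1|^2]; as [K >= 1], also [K <= K^2], so [K] itself serves as
   Lipschitz constant without a square root. *)
exists e => // S Sq; pose K := 2 * A / c + 1.
have K1 : 1 <= K by rewrite /K lerDr divr_ge0// ?mulr_ge0// ltW.
have [||f [lf Sf]] := @mcshane_rV k m (L @^-1` S) K.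
- lra.
- move=> x y /= Sx Sy; have := Sq _ _ Sx Sy; rewrite -linearB.
  have := qL (x - y); have := LC (x - y).
  set d := x - y; rewrite -[x.1 - _]/d.1 -[x.2 - _]/d.2.
  have dle : `|d| ^+ 2 <= `|d.1| ^+ 2 + `|d.2| ^+ 2.
    rewrite prod_normE; have := sqr_ge0 `|d.1|; have := sqr_ge0 `|d.2|.
    by case: (leP `|d.1| `|d.2|) => _; lra.
  have d1 := normr_ge0 d.1; have d2 := normr_ge0 d.2; have dd := normr_ge0 d.
  have Ld := normr_ge0 (L d).
  move=> h1 h2 h3.
  have h4 : e * `|L d| ^+ 2 <= c / 2 * (`|d.1| ^+ 2 + `|d.2| ^+ 2).
    apply: (@le_trans _ _ (e * (C * `|d|) ^+ 2)).
      by rewrite ler_wpM2l ?(ltW e0)// ler_sqr ?nnegrE// mulr_ge0.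
    rewrite exprMn mulrA; apply: ler_pM => //; rewrite ?sqr_ge0//.
    by rewrite mulr_ge0 ?sqr_ge0// ltW.
  have h5 : `|d.2| ^+ 2 <= K * `|d.1| ^+ 2.
    rewrite -(ler_pM2l c0).
    have -> : c * (K * `|d.1| ^+ 2) = 2 * A * `|d.1| ^+ 2 + c * `|d.1| ^+ 2.
      by rewrite /K; field; rewrite gt_eqF.
    lra.
  rewrite -ler_sqr ?nnegrE ?mulr_ge0//; last lra.
  apply: (le_trans h5); rewrite exprMn ler_wpM2r ?sqr_ge0//; nra.
- exists (range (fun u => L (u, f u))); first exact: graph_submanifold.
  move=> p Sp; have [G LK GK] := Lb; exists (G p).1 => //.
  rewrite -[RHS](GK p); congr (L _); rewrite (Sf (G p)) /= ?GK//.
  by case: (G p).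
Qed.

End cone.

(** * Coordinates diagonalising the second-order form *)

Section coordinates.
Context {R : realType}.

(** The Euclidean product, suited to completing squares; its square is compared below with that of
    the sup norm. *)
Definition dot n (u v : 'rV[R]_n) : R := (u *m v^T) 0 0.

Lemma dotE n (u v : 'rV[R]_n) : dot u v = \sum_i u 0 i * v 0 i.
Proof. by rewrite /dot mxE; apply: eq_bigr => i _; rewrite mxE. Qed.

Lemma dot_ge0 n (v : 'rV[R]_n) : 0 <= dot v v.
Proof. by rewrite dotE sumr_ge0// => i _; rewrite -expr2 sqr_ge0. Qed.

Lemma dot_le_norm n (v : 'rV[R]_n) : dot v v <= n%:R * `|v| ^+ 2.
Proof.
rewrite expr2; apply: (le_trans (ler_norm _)).
by apply: dot_bound; exact: coord_le_norm.
Qed.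

Lemma norm_le_dot n (v : 'rV[R]_n) : `|v| ^+ 2 <= dot v v.
Proof.
have [v0|/mx_norm_neq0[[i j] /= vE]] := eqVneq `|v| 0.
  by rewrite v0 expr0n dot_ge0.
rewrite -[`|v|]/(mx_norm v) vE real_normK ?num_real// dotE (bigD1 j)//= ord1.
by rewrite expr2 lerDl sumr_ge0// => k _; rewrite -expr2 sqr_ge0.
Qed.

Lemma dot_split n (v : 'rV[R]_(1 + n)) :
  dot v v = lsubmx v 0 0 ^+ 2 + dot (rsubmx v) (rsubmx v).
Proof.
rewrite !dotE big_split_ord big_ord1 /= !mxE expr2; congr (_ + _).
by apply: eq_bigr => i _; rewrite !mxE.
Qed.

Lemma rsubmx_norm n (v : 'rV[R]_(1 + n)) : `|rsubmx v| <= `|v|.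
Proof.
apply: mx_norm_le => // i j; rewrite mxE; exact: coord_le_norm.
Qed.

Section nonsingular.
Variables (n : nat) (H : 'M[R]_n).
Hypothesis HU : H \in unitmx.
Local Notation T := (triple_space R n).

(** Completing the square: with [a = (H^-1 g1^T)^T], [w = D1 H] and [z = D2],
    [w . z + t (w . a + z . g2) = (w + t g2) . (z + t a) - t^2 (g2 . a)],
    and [w + t g2 = u + y], [z + t a = u - y] are the new coordinates. *)
Lemma cross_form_coordinates (g1 g2 : 'rV[R]_n) :
  exists2 L : {linear ('rV[R]_n * 'rV[R]_(1 + n))%type -> T}, bijective L &
    forall d, cross_form H g1 g2 (L d) =
      dot d.1 d.1 - dot (rsubmx d.2) (rsubmx d.2) -
      (g2 *m invmx H *m g1^T) 0 0 * lsubmx d.2 0 0 ^+ 2.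
Proof.
pose a := (invmx H *m g1^T)^T.
pose f (d : 'rV[R]_n * 'rV[R]_(1 + n)) : T :=
  (lsubmx d.2 0 0,
   (d.1 + rsubmx d.2 - lsubmx d.2 0 0 *: g2) *m invmx H,
   d.1 - rsubmx d.2 - lsubmx d.2 0 0 *: a).
have [L LE] : exists L : {linear ('rV[R]_n * 'rV[R]_(1 + n))%type -> T},
    forall x, L x = f x.
  apply: linear_exists => k x y; rewrite /f; congr ((_, _), _) => /=.
  - by rewrite !mxE.
  - rewrite scalemxAl -mulmxDl; congr (_ *m _).
    by apply/rowP => i; rewrite !mxE; ring.
  - by apply/rowP => i; rewrite !mxE; ring.
exists L.
  exists (fun D : T =>
    (2^-1 *: ((D.1.2 *m H + D.1.1 *: g2) + (D.2 + D.1.1 *: a)),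
     row_mx (D.1.1)%:M
       (2^-1 *: ((D.1.2 *m H + D.1.1 *: g2) - (D.2 + D.1.1 *: a))))).
    move=> [u v]; rewrite LE /f /= mulmxKV//; congr pair.
      by apply/rowP => i; rewrite !mxE; lra.
    rewrite -[RHS]hsubmxK; congr row_mx.
      by apply/matrixP => i j; rewrite !ord1 !mxE mulr1n.
    by apply/rowP => i; rewrite !mxE; lra.
  move=> [[t p] q]; rewrite LE /f /= row_mxKl row_mxKr.
  have -> : (t%:M : 'rV[R]_1) 0 0 = t by rewrite mxE mulr1n.
  congr ((_, _), _).
  - rewrite -[RHS](mulmxK HU); congr (_ *m _).
    by apply/rowP => i; rewrite !mxE; lra.
  - by apply/rowP => i; rewrite !mxE; lra.
move=> d; rewrite LE /cross_form /f /= mulmxKV// -!mulmxA.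
have -> : invmx H *m g1^T = a^T by rewrite /a trmxK.
(* Both sides are sums over coordinates, so one polynomial identity per index suffices. *)
rewrite -!/(dot _ _) !dotE -big_split/= mulr_sumr -big_split/= mulr_suml.
by rewrite -!sumrB; apply: eq_bigr => i _; rewrite !mxE; ring.
Qed.

(** The same coordinates with [t] counted as a positive direction, which is
    harmless whatever the sign of the last term. *)
Lemma cross_form_coordinates_shift (g1 g2 : 'rV[R]_n) :
  exists2 L : {linear ('rV[R]_(1 + n) * 'rV[R]_n)%type -> T}, bijective L &
    forall d, cross_form H g1 g2 (L d) =
      dot (rsubmx d.1) (rsubmx d.1) - dot d.2 d.2 -
      (g2 *m invmx H *m g1^T) 0 0 * lsubmx d.1 0 0 ^+ 2.
Proof.
have [L Lb qL] := cross_form_coordinates g1 g2.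
pose f (d : 'rV[R]_(1 + n) * 'rV[R]_n) : 'rV[R]_n * 'rV[R]_(1 + n) :=
  (rsubmx d.1, row_mx (lsubmx d.1) d.2).
have [L' LE] : exists L' : {linear ('rV[R]_(1 + n) * 'rV[R]_n)%type -> T},
    forall x, L' x = L (f x).
  apply: linear_exists => k x y; rewrite -linearP; congr (L (_, _)) => /=.
    by rewrite linearP.
  by rewrite scale_row_mx add_row_mx linearP.
have fb : bijective f.
  exists (fun d => (row_mx (lsubmx d.2) d.1, rsubmx d.2)) => -[u v].
    by rewrite /f /= !row_mxKl !row_mxKr hsubmxK.
  by rewrite /f /= !row_mxKl !row_mxKr hsubmxK.
exists L'; first by apply: (eq_bij (bij_comp Lb fb)) => x; rewrite LE.
by move=> d; rewrite LE qL /f /= row_mxKl row_mxKr.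
Qed.

End nonsingular.
End coordinates.

Theorem proposition28 (R : realType) (n : nat) (X1 X2 : set 'rV[R]_n)
    (b : pair_space R n -> R) (b_C2 : C2 b)
    (alpha : R -> R)
    (alpha_ge0 : forall t : R, 0 <= t <= 1 -> 0 <= alpha t)
    (alpha_nondecreasing :
       forall s t : R, 0 <= s -> s <= t -> t <= 1 -> alpha s <= alpha t)
    (mu1 mu2 : probability (borel 'rV[R]_n) R)
    (mu1_X1 : concentrated_on mu1 X1) (mu2_X2 : concentrated_on mu2 X2)
    (abar : R) (x1bar x2bar : 'rV[R]_n)
    (abar_gt0 : 0 < abar) (x1bar_X1 : X1 x1bar) (x2bar_X2 : X2 x2bar)
    (nonsingular : mixed_hessian b (x1bar, x2bar) \in unitmx)
    (pi : probability (borel (triple_space R n)) R)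
    (pi_max : maximizes b (couplings X1 X2 (spectral_law alpha) mu1 mu2) pi) :
  locally_in_submanifold_of_dim_le n.+1
    (support_in pi (product_domain X1 X2)) (abar, x1bar, x2bar) /\
  (0 < (grad2 b (x1bar, x2bar) *m invmx (mixed_hessian b (x1bar, x2bar))
          *m (grad1 b (x1bar, x2bar))^T) 0 0 ->
   locally_in_submanifold_of_dim_le n
    (support_in pi (product_domain X1 X2)) (abar, x1bar, x2bar)).
Proof.
set g1 := grad1 b _; set g2 := grad2 b _.
pose H := abar *: mixed_hessian b (x1bar, x2bar).
have a_unit : abar \is a GRing.unit by rewrite unitfE gt_eqF.
have HU : H \in unitmx by rewrite unitmxZ.
have n0 : 0 <= n%:R :> R by [].
have near e := support_spacelike x1bar x2bar (e := e) b_C2 pi_max abar_gt0.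
split.
  have [L Lb qL] := cross_form_coordinates_shift HU g1 g2.
  set k := (_ *m _) 0 0 in qL.
  (* The [n] coordinates [d.2] are negative, which leaves a graph over the other [n + 1]. In the
     constant, [n] passes from Euclidean squares to the sup norm and [|k|] bounds the last term
     whatever its sign. *)
  have [||e e0 sub] := @spacelike_submanifold R _ _ _ L
    (cross_form H g1 g2) (n%:R + `|k|) 1 Lb _ ltr01.
  - exact: addr_ge0.
  - move=> d; rewrite qL mul1r addrAC; apply: lerB; last exact: norm_le_dot.
    rewrite mulrDl; apply: lerD.
      apply: (le_trans (dot_le_norm _)); rewrite ler_wpM2l// ler_sqr ?nnegrE//.
      exact: rsubmx_norm.
    apply: (le_trans (ler_norm _)).
    rewrite normrN normrM ler_wpM2l// normrX ler_sqr ?nnegrE//.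
    by rewrite mxE; exact: coord_le_norm.
  have [N xN Nq] := near e e0.
  have [|M Mm SM] := sub (support_in pi (product_domain X1 X2) `&` N).
    exact: Nq.
  by exists N, M, n.+1; split.
move=> k_gt0; have [L Lb qL] := cross_form_coordinates HU g1 g2.
set k := (g2 *m invmx H *m _) 0 0 in qL.
(* Replacing the mixed Hessian by [H] divides the quantity by [abar > 0], which keeps its sign. *)
have k0 : 0 < k.
  rewrite /k /H invmxZ// -scalemxAr -scalemxAl mxE.
  by rewrite mulr_gt0// invr_gt0.
(* Now the [x0] direction is negative too, with weight [k] against 1 for the others, so [n + 1]
   coordinates depend on the remaining [n]. *)
have c0 : 0 < Num.min 1 k by rewrite lt_min ltr01.
have [|e e0 sub] := @spacelike_submanifold R _ _ _ L
    (cross_form H g1 g2) n%:R (Num.min 1 k) Lb n0 c0.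
  move=> d; rewrite qL -addrA -opprD; apply: lerB; first exact: dot_le_norm.
  apply: (le_trans (ler_wpM2l (ltW c0) (norm_le_dot _))).
  rewrite dot_split mulrDr addrC; apply: lerD.
    by rewrite ler_piMl ?dot_ge0// ge_min lexx.
  by rewrite ler_wpM2r ?sqr_ge0// ge_min lexx orbT.
have [N xN Nq] := near e e0.
have [|M Mm SM] := sub (support_in pi (product_domain X1 X2) `&` N).
  exact: Nq.
by exists N, M, n; split.
Qed.
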